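(* For $n\ge 1$ let $r_n$ (resp. $d_n$) be the number of occurrences of the pattern $12$ (resp. $21$), i.e. the number of rises (resp. descents), in the $n$-th Peano word $X_n$. Then for all integers $k\ge 0$, $$r_{2k+1}=\frac{2}{5}\left(4\cdot 16^k+1\right),\qquad r_{2k+2}=\frac{2}{5}\left(16^{k+1}-1\right),$$ $$d_{2k+1}=\frac{8}{5}\left(16^k-1\right),\qquad d_{2k+2}=\frac{2}{5}\left(16^{k+1}-1\right).$$
   Context: All words are finite words over the alphabet $\{1,2,3,4\}$, with the usual order on letters. For a word $A$, $\varphi_1(A)$ is the word obtained by reversing $A$ and then replacing each letter according to $1\mapsto 4$, $2\mapsto 1$, $3\mapsto 2$, $4\mapsto 3$; $\varphi_2(A)$ is the word obtained by reversing $A$ and then replacing each letter according to $1\mapsto 2$, $2\mapsto 3$, $3\mapsto 4$, $4\mapsto 1$. The Peano words $X_n$ ($n\ge1$) are defined by $X_1=123$ and, for $n\ge 2$, the concatenation $X_n=\varphi_1(X_{n-1})\,1\,X_{n-1}\,2\,X_{n-1}\,3\,\varphi_2(X_{n-1})$; for example $X_2=214112321233432$. An occurrence of the pattern $12$ (a rise) in a word $w_1w_2\cdots w_m$ is an index $i$ with $1\le i<m$ and $w_i<w_{i+1}$; an occurrence of the pattern $21$ (a descent) is an index $i$ with $1\le i<m$ and $w_i>w_{i+1}$. *)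

(* Defs.v *)
From mathcomp Require Import all_boot.
Set Implicit Arguments.
Unset Strict Implicit.
Unset Printing Implicit Defensive.

(* The alphabet {1, 2, 3, 4} is encoded as 'I_4, the ordinal
   i standing for the letter i + 1; the order on letters is the order on 'I_4. *)
Definition letter := 'I_4.
Definition word := seq letter.

Definition l1 : letter := @Ordinal 4 0 isT.
Definition l2 : letter := @Ordinal 4 1 isT.
Definition l3 : letter := @Ordinal 4 2 isT.
Definition l4 : letter := @Ordinal 4 3 isT.

(* ord_pred and ordS are cyclic: 1 |-> 4, 2 |-> 1, 3 |-> 2, 4 |-> 3 and
   1 |-> 2, 2 |-> 3, 3 |-> 4, 4 |-> 1 respectively. *)
Definition phi1 (A : word) : word := [seq ord_pred x | x <- rev A].
Definition phi2 (A : word) : word := [seq ordS x | x <- rev A].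

(* The words X_n are indexed by n >= 1; the value at 0 is a dummy. *)
Fixpoint peano (n : nat) : word :=
  match n with
  | 0 => [::]
  | 1 => [:: l1; l2; l3]
  | m.+1 => phi1 (peano m) ++ [:: l1] ++ peano m ++ [:: l2] ++ peano m
              ++ [:: l3] ++ phi2 (peano m)
  end.

(* Positions are 0-based: i ranges over 0 <= i < size w - 1, so both lookups
   are in range and the default l1 is never used. *)
Definition rises (w : word) : nat :=
  #|[set i : 'I_(size w).-1 | nth l1 w i < nth l1 w i.+1]|.
Definition descents (w : word) : nat :=
  #|[set i : 'I_(size w).-1 | nth l1 w i.+1 < nth l1 w i]|.

Lemma phi1_letters :
  phi1 [:: l1; l2; l3; l4] = [:: l3; l2; l1; l4].
Proof. exact/eqP. Qed.

Lemma phi2_letters :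
  phi2 [:: l1; l2; l3; l4] = [:: l1; l4; l3; l2].
Proof. exact/eqP. Qed.

Lemma peano2E : peano 2 =
  [:: l2; l1; l4; l1; l1; l2; l3; l2; l1; l2; l3; l3; l4; l3; l2].
Proof. exact/eqP. Qed.

(* Main.v *)
Require Import Defs.
From mathcomp Require Import all_boot all_order all_algebra.
From mathcomp Require Import zify lra.
Import GRing.Theory Num.Theory.
Local Open Scope ring_scope.

(** Up to a shift of letters, [phi1] and [phi2] exchange rises and descents; a
    step can only be miscounted where the cyclic shift wraps around, that is
    where the word enters or leaves the letter 1 (for [phi1]) or 4 (for [phi2]).
    These corrections telescope, so they depend on the end letters of the word
    only.  The end letters of [peano n] are (1, 3) for odd n and (2, 2) for even
    n, whence r_(n+1) = 2 (r_n + d_n) + 2 for all n, while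
    d_(n+1) = 2 (r_n + d_n) + 2 or 2 (r_n + d_n) as n is odd or even. *)

Section Steps.
Local Open Scope nat_scope.
Variable T : Type.
Implicit Types (e : rel T) (s t : seq T) (x y : T).

Fixpoint steps e s : nat :=
  if s is x :: t then (if t is y :: _ then e x y : nat else 0) + steps e t
  else 0.

(** The letter [y] is kept in both halves, so the pair straddling the cut is still counted. *)
Lemma steps_cat_cons e s y t :
  steps e (s ++ y :: t) = steps e (rcons s y) + steps e (y :: t).
Proof.
elim: s => [|x s IHs] //=.
by rewrite IHs; case: s {IHs} => [|x' s] /=; rewrite !addnA.
Qed.

Lemma steps_rcons2 e s x y :
  steps e (rcons (rcons s x) y) = steps e (rcons s x) + e x y.
Proof. by rewrite -cats1 cat_rcons steps_cat_cons /= !addn0. Qed.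

Lemma steps_rev e s : steps e (rev s) = steps (fun x y => e y x) s.
Proof.
elim: s => // x [|y s] IHs //.
by rewrite rev_cons rev_cons steps_rcons2 -rev_cons IHs [RHS]/= addnC.
Qed.

(** Summing [e1 a b - e2 a b = P a - P b] along the word leaves only its two ends; the terms are
    moved across to avoid truncated subtraction. *)
Lemma steps_telescope e1 e2 (P : pred T) x s :
  (forall a b, e1 a b + P b = e2 a b + P a) ->
  steps e1 (x :: s) + P (last x s) = steps e2 (x :: s) + P x.
Proof.
move=> e12; elim: s x => //= y s IHs x.
by have := e12 x y; have /= := IHs y; lia.
Qed.

Lemma steps_card x0 e s :
  steps e s = #|[set i : 'I_(size s).-1 | e (nth x0 s i) (nth x0 s i.+1)]|.
Proof.
rewrite cardsE -sum1_card big_mkcond /=.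
elim: s => [|x [|y s] IHs]; rewrite ?big_ord0 //=.
by rewrite big_ord_recl [X in _ + X]IHs; congr (_ + _).
Qed.

End Steps.

Arguments steps {T} e s.
Arguments steps_telescope {T e1 e2}.

Lemma steps_map (T U : Type) (f : U -> T) (e : rel T) (s : seq U) :
  steps e (map f s) = steps (relpre f e) s.
Proof. by elim: s => // x [|y s] //= ->. Qed.

Local Notation rise := (fun a b : letter => (a < b)%N).
Local Notation fall := (fun a b : letter => (b < a)%N).

Lemma risesE w : rises w = steps rise w.
Proof. by rewrite (steps_card _ l1). Qed.

Lemma descentsE w : descents w = steps fall w.
Proof. by rewrite (steps_card _ l1). Qed.

(** Reversal turns rises into descents, and [ord_pred] keeps the order of 2, 3, 4 but makes 1 the
    largest letter, so [P] tests for the letter 1. *)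
Lemma rises_phi1 x s :
  (rises (phi1 (x :: s)) + (last x s == l1) = descents (x :: s) + (x == l1))%N.
Proof.
rewrite risesE descentsE /phi1 steps_map steps_rev.
apply: (steps_telescope (pred1 l1)).
(* The local identity is checked on all sixteen pairs of letters. *)
by do 2![case; do 4?[case=> [?|] //]].
Qed.

Lemma descents_phi1 x s :
  (descents (phi1 (x :: s)) + (x == l1) = rises (x :: s) + (last x s == l1))%N.
Proof.
rewrite risesE descentsE /phi1 steps_map steps_rev; apply/esym.
apply: (steps_telescope (pred1 l1)).
by do 2![case; do 4?[case=> [?|] //]].
Qed.

Lemma rises_phi2 x s :
  (rises (phi2 (x :: s)) + (x == l4) = descents (x :: s) + (last x s == l4))%N.
Proof.
rewrite risesE descentsE /phi2 steps_map steps_rev; apply/esym.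
apply: (steps_telescope (pred1 l4)).
by do 2![case; do 4?[case=> [?|] //]].
Qed.

Lemma descents_phi2 x s :
  (descents (phi2 (x :: s)) + (last x s == l4) = rises (x :: s) + (x == l4))%N.
Proof.
rewrite risesE descentsE /phi2 steps_map steps_rev.
apply: (steps_telescope (pred1 l4)).
by do 2![case; do 4?[case=> [?|] //]].
Qed.

Definition peano_next (w : word) : word :=
  phi1 w ++ [:: l1] ++ w ++ [:: l2] ++ w ++ [:: l3] ++ phi2 w.

Lemma peanoS n : peano n.+2 = peano_next (peano n.+1).
Proof. by []. Qed.

(** Both decompositions are recorded because reversal exchanges the two ends of [w]. *)
Definition ends (x z : letter) (w : word) :=
  (exists s, w = x :: s) /\ (exists u, w = rcons u z).

Lemma ends_last {x z s} : ends x z (x :: s) -> last x s = z.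
Proof. by case=> _ [u /(congr1 (last x))]; rewrite last_rcons. Qed.

Lemma ends_next x z w :
  ends x z w -> ends (ord_pred z) (ordS x) (peano_next w).
Proof.
case=> -[s Es] [u Eu]; split.
  by rewrite /peano_next {1}Eu /phi1 rev_rcons /=; eexists.
rewrite /peano_next [in phi2 w]Es /phi2 rev_cons map_rcons.
by rewrite -!rcons_cat; eexists.
Qed.

(** The six extra terms are the junctions on either side of the separators 1, 2, 3; by reversal
    [phi1 w] ends with [ord_pred x] and [phi2 w] starts with [ordS z]. *)
Lemma steps_next e x z w : ends x z w ->
  steps e (peano_next w) =
    (steps e (phi1 w) + steps e w + steps e w + steps e (phi2 w)
     + (e (ord_pred x) l1 + e l1 x + e z l2 + e l2 x + e z l3
        + e l3 (ordS z)))%N.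
Proof.
case=> -[s Es] [u Eu].
have E1 : phi1 w = rcons (map (@ord_pred 4) (rev s)) (ord_pred x).
  by rewrite Es /phi1 rev_cons map_rcons.
have E2 : phi2 w = ordS z :: map (@ordS 4) (rev u).
  by rewrite Eu /phi2 rev_rcons.
have to_w y t : steps e (y :: w ++ t) = (e y x + steps e (w ++ t))%N.
  by rewrite Es.
have from_w y : steps e (rcons w y) = (steps e w + e z y)%N.
  by rewrite Eu steps_rcons2.
have to_phi2 y : steps e (y :: phi2 w) = (e y (ordS z) + steps e (phi2 w))%N.
  by rewrite E2.
have from_phi1 y :
    steps e (rcons (phi1 w) y) = (steps e (phi1 w) + e (ord_pred x) y)%N.
  by rewrite E1 steps_rcons2.
rewrite /peano_next /= steps_cat_cons from_phi1 to_w steps_cat_cons from_w.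
by rewrite to_w steps_cat_cons from_w to_phi2; lia.
Qed.

(** For rises, [phi1] contributes a correction of 1 and one junction rises; for descents, the
    correction is -1 and three junctions fall. *)
Lemma next_ends13 w (r := rises w) (d := descents w) : ends l1 l3 w ->
  [/\ ends l2 l2 (peano_next w),
      rises (peano_next w) = (2 * (r + d) + 2)%N &
      descents (peano_next w) = (2 * (r + d) + 2)%N].
Proof.
move=> Hw; split.
- have := ends_next _ _ _ Hw.
  (* The shifted letters agree with the named ones as numbers, hence as ordinals. *)
  by congr ends; apply/val_inj.
- rewrite risesE (steps_next _ _ _ _ Hw) -!risesE {}/r {}/d /=.
  case: (Hw) => -[s Es] _; rewrite {}Es in Hw *.
  have := rises_phi1 l1 s; have := rises_phi2 l1 s.
  by rewrite (ends_last Hw) /=; lia.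
- rewrite descentsE (steps_next _ _ _ _ Hw) -!descentsE {}/r {}/d /=.
  case: (Hw) => -[s Es] _; rewrite {}Es in Hw *.
  have := descents_phi1 l1 s; have := descents_phi2 l1 s.
  by rewrite (ends_last Hw) /=; lia.
Qed.

(** No correction arises here: two junctions rise and none falls. *)
Lemma next_ends22 w (r := rises w) (d := descents w) : ends l2 l2 w ->
  [/\ ends l1 l3 (peano_next w),
      rises (peano_next w) = (2 * (r + d) + 2)%N &
      descents (peano_next w) = (2 * (r + d))%N].
Proof.
move=> Hw; split.
- have := ends_next _ _ _ Hw.
  by congr ends; apply/val_inj.
- rewrite risesE (steps_next _ _ _ _ Hw) -!risesE {}/r {}/d /=.
  case: (Hw) => -[s Es] _; rewrite {}Es in Hw *.
  have := rises_phi1 l2 s; have := rises_phi2 l2 s.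
  by rewrite (ends_last Hw) /=; lia.
- rewrite descentsE (steps_next _ _ _ _ Hw) -!descentsE {}/r {}/d /=.
  case: (Hw) => -[s Es] _; rewrite {}Es in Hw *.
  have := descents_phi1 l2 s; have := descents_phi2 l2 s.
  by rewrite (ends_last Hw) /=; lia.
Qed.

(** The end letters have period two, so the induction advances two words at a time. Clearing the
    factor 5 and the subtraction keeps the formulas in [nat]. *)
Lemma peano_odd k (w := peano (2 * k).+1) :
  [/\ ends l1 l3 w, (5 * rises w = 8 * 16 ^ k + 2)%N
    & (5 * descents w + 8 = 8 * 16 ^ k)%N].
Proof.
rewrite {}/w; elim: k => [|k [Hw rw dw]].
  rewrite muln0 risesE descentsE; split=> //.
  by split; [exists [:: l2; l3] | exists [:: l1; l2]].
rewrite mulnS !peanoS; have [Hw' rw' dw'] := next_ends13 _ Hw.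
have [Hw'' rw'' dw''] := next_ends22 _ Hw'.
by split=> //; rewrite expnS; lia.
Qed.

Theorem theorem4 (k : nat) :
  [/\ (rises (peano (2 * k + 1)%N))%:R = 2 / 5 * (4 * 16 ^+ k + 1) :> rat,
      (rises (peano (2 * k + 2)%N))%:R = 2 / 5 * (16 ^+ k.+1 - 1) :> rat,
      (descents (peano (2 * k + 1)%N))%:R = 8 / 5 * (16 ^+ k - 1) :> rat &
      (descents (peano (2 * k + 2)%N))%:R = 2 / 5 * (16 ^+ k.+1 - 1) :> rat].
Proof.
rewrite addn1 addn2 peanoS; have [Hw rw dw] := peano_odd k.
(* The even case is one step beyond the odd one. *)
have [_ -> ->] := next_ends13 _ Hw.
(* Once cast to [rat], all four goals are linear in [16 ^+ k]. *)
have := congr1 (fun n => n%:R : rat) rw; have := congr1 (fun n => n%:R : rat) dw.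
rewrite /= !(natrD, natrM, natrX) exprS => dw' rw'.
by split; lra.
Qed.
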